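(* Let $(d_k,d_{k-1},\ldots,d_0)_b$ be a shifted-symmetric $(n,b)$-palintiple with carries $c_k,c_{k-1},\ldots,c_0$. Suppose there exists a natural number $\hat{n}$ such that $s=\frac{\hat{n}(nb-1)}{b-n}$ is an integer, and such that $\hat{n}>d_j$ and $s\,\frac{(nb-1)c_j}{n^2-1}\equiv \frac{(b-n)c_j}{n^2-1}\pmod{\hat{n}-1}$ for all $0\le j\le k$. Then for every integer $\alpha\ge 1$ such that $\gcd(d_0,\hat{n}^2-1)$ divides $$\alpha\,\frac{(b-n)(c_{j+1}+\hat{n}c_{j-1})+(\hat{n}+1)(nb-1)c_j}{n^2-1}$$ for all $0\le j\le k$, there exists an asymmetric $(k+2)$-digit $(\hat{n},\hat{b})$-palintiple with carries $(\hat{c}_{k+1},\hat{c}_k,\ldots,\hat{c}_0)=(d_k,d_{k-1},\ldots,d_0,0)$, where $\hat{b}=s+\alpha\,\frac{\hat{n}^2-1}{\gcd(d_0,\hat{n}^2-1)}$.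
   Context: For integers $1<n<b$ and $k\ge 1$, write $(d_k,\ldots,d_0)_b=\sum_{j=0}^k d_jb^j$ with digits $0\le d_j<b$. It is called a $(k+1)$-digit $(n,b)$-palintiple (with multiplier $n$ and base $b$) if $d_k\neq 0$ (no leading zeros) and $(d_k,d_{k-1},\ldots,d_0)_b=n\,(d_0,d_1,\ldots,d_k)_b$. Its carries $c_k,\ldots,c_0$ are those of the base-$b$ single-digit multiplication: $c_0=0$ and $n d_{k-j}+c_j=d_j+b\,c_{j+1}$ for $0\le j\le k$ (so $c_{j+1}=\lfloor (n d_{k-j}+c_j)/b\rfloor$), with $c_{k+1}=0$. By convention $c_{-1}=0$. The palintiple is symmetric if $c_j=c_{k-j}$ for all $0\le j\le k$; shifted-symmetric if $c_j=c_{k-j+1}$ for all $0\le j\le k$; asymmetric if it is neither symmetric nor shifted-symmetric (for a palintiple with $K+1$ digits, replace $k$ by $K$ in these definitions). For a shifted-symmetric $(n,b)$-palintiple it is known that $(b-n)c_j\equiv(nb-1)c_j\equiv 0\pmod{n^2-1}$ for all $j$, so the fractions with denominator $n^2-1$ in the claim are integers. *)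

(* Defs.v *)
From mathcomp Require Import all_boot.
From mathcomp Require Import zify.

Set Implicit Arguments.
Unset Strict Implicit.
Unset Printing Implicit Defensive.

(* Digit and carry strings are stored least significant entry first, so the
   written (d_k, ..., d_0) is [:: d_0; ...; d_k] and d_j is nth 0 d j.  Out of
   range entries are 0; in particular the carry c_(k+1) of a string of k+1
   carries is 0 without any further hypothesis. *)

Definition digits_value (b : nat) (s : seq nat) : nat :=
  \sum_(j < size s) nth 0 s j * b ^ j.

Definition palintiple (n b k : nat) (d : k.+1.-tuple nat) : Prop :=
  [/\ 1 < n < b,
      1 <= k,
      forall j, j <= k -> nth 0 d j < b,
      nth 0 d k <> 0
    & digits_value b d = n * digits_value b (rev d)].

(* For j = k the equation involves c_(k+1) = 0, i.e. there is no carry out. *)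
Definition carries (n b k : nat) (d c : k.+1.-tuple nat) : Prop :=
  nth 0 c 0 = 0 /\
  forall j, j <= k ->
    n * nth 0 d (k - j) + nth 0 c j = nth 0 d j + b * nth 0 c j.+1.

Definition symmetric_carries (k : nat) (c : k.+1.-tuple nat) : Prop :=
  forall j, j <= k -> nth 0 c j = nth 0 c (k - j).

Definition shifted_symmetric_carries (k : nat) (c : k.+1.-tuple nat) : Prop :=
  forall j, j <= k -> nth 0 c j = nth 0 c (k - j).+1.

Definition shifted_symmetric_palintiple
    (n b k : nat) (d c : k.+1.-tuple nat) : Prop :=
  [/\ palintiple n b d, carries n b d c & shifted_symmetric_carries c].

Definition asymmetric_palintiple
    (n b k : nat) (d c : k.+1.-tuple nat) : Prop :=
  [/\ palintiple n b d, carries n b d c,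
      ~ symmetric_carries c & ~ shifted_symmetric_carries c].

(* c_(j-1), with the convention c_(-1) = 0. *)
Definition prev_carry (c : seq nat) (j : nat) : nat := nth 0 (0 :: c) j.

Lemma shifted_symmetric_digit (n b k : nat) (d c : k.+1.-tuple nat) (j : nat) :
  shifted_symmetric_palintiple n b d c -> j <= k ->
  (n ^ 2 - 1) * nth 0 d j = (b - n) * nth 0 c j.+1 + (n * b - 1) * nth 0 c j.
Proof.
move=> [[/andP[n1 nb] _ _ _ _] [_ cE] sym] jk.
have E1 := cE j jk; have E2 := cE (k - j) (leq_subr j k).
have S1 := sym (k - j) (leq_subr j k); have S2 := sym j jk.
rewrite subKn // in E2 S1; rewrite -S2 S1 in E2.
by nia.
Qed.

(* The truncated divisions by n ^ 2 - 1 of these products are exact. *)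
Lemma shifted_symmetric_dvd (n b k : nat) (d c : k.+1.-tuple nat) (j : nat) :
  shifted_symmetric_palintiple n b d c ->
  (n ^ 2 - 1 %| (b - n) * nth 0 c j) && (n ^ 2 - 1 %| (n * b - 1) * nth 0 c j).
Proof.
move=> P; have [[/andP[n1 nb] _ _ _ _] [c0 _] _] := P.
have stepA x : n ^ 2 - 1 %| (b - n) * x -> n ^ 2 - 1 %| (n * b - 1) * x.
  have -> : (n * b - 1) * x = n * ((b - n) * x) + (n ^ 2 - 1) * x by nia.
  by move=> h; rewrite (dvdn_add (dvdn_mull n h) (dvdn_mulr x (dvdnn _))).
elim: j => [|j /andP[_ IH]]; first by rewrite c0 !muln0 dvdn0.
suff h : n ^ 2 - 1 %| (b - n) * nth 0 c j.+1 by rewrite h stepA.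
have [jk|kj] := leqP j k; last by rewrite nth_default ?muln0 // size_tuple ltnW.
by rewrite -(dvdn_addl _ IH) -(shifted_symmetric_digit P jk) dvdn_mulr.
Qed.

(* Main.v *)
Require Import Defs.
From mathcomp Require Import all_boot.
From mathcomp Require Import zify.

Set Implicit Arguments.
Unset Strict Implicit.
Unset Printing Implicit Defensive.

(** In a shifted-symmetric palintiple the two carry equations that involve
    [d_j] and [d_(k-j)] can be solved for the digits: with
    [p_j = (b - n) c_j / (n ^ 2 - 1)] and [q_j = (n b - 1) c_j / (n ^ 2 - 1)],
    both integers, one gets [d_j = p_(j+1) + q_j] ([digit_of_parts]).

    Asking for a palintiple of multiplier [N] and base [B] whose carries are
    [0, d_0, ..., d_k] gives, in the same way, a linear system with the unique
    solution
      [(N ^ 2 - 1) x_j = N (B d_(k+1-j) - d_(k-j)) + B d_j - d_(j-1)].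
    Substituting [d_j = p_(j+1) + q_j] and the symmetry [c_j = c_(k+1-j)] turns
    the right-hand side into an expression in [c_(j-1), c_j, c_(j+1)] only.
    Since [s] is chosen so that [s p_j = N q_j] ([scaled_parts]), the share of
    [s] in [B = s + alpha (N ^ 2 - 1) / g] collapses, and
      [x_j = q_(j-1) + (s q_j - p_j) / (N - 1)
             + alpha (p_(j+1) + N p_(j-1) + (N + 1) q_j) / g].
    The congruence hypothesis makes the first quotient exact and the
    divisibility hypothesis the second one; this is [lifted_digit], and
    [lifted_digits_carries] checks that it solves the carry equations.

    A solution of the carry equations without carry out has the palintiple
    value by telescoping ([carries_value]). Its digits lie below [B]: since all
    [d_j] are below [N], the formula for [x_j] gives [x_j <= B], and equality
    would need [d_j = N - 1] and [d_(k-j) = 0] ([carries_digit_leq]), while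
    [d_j] vanishes whenever [d_(k-j)] does ([digit_mirror_eq0]).

    The new carries are not symmetric because [0] faces [d_k], and not
    shifted-symmetric because [d_0 = p_1] faces [d_k = q_1 > p_1]. *)

(** * Carry equations of a reversal product *)

(** The carry equations telescope: summed with weights [b ^ j], everything
    cancels but [c_0] and the carry out, both zero. *)
Lemma carries_value (n b k : nat) (d c : k.+1.-tuple nat) :
  carries n b d c -> digits_value b d = n * digits_value b (rev d).
Proof.
move=> [c0 cE]; rewrite /digits_value size_rev size_tuple.
have partial m : m <= k.+1 ->
    n * (\sum_(j < m) nth 0 (rev d) j * b ^ j)
    = \sum_(j < m) nth 0 d j * b ^ j + b ^ m * nth 0 c m.
  elim: m => [|m IH] mk; first by rewrite !big_ord0 c0 !muln0.
  rewrite !big_ord_recr /= mulnDr IH; last exact: ltnW.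
  rewrite nth_rev size_tuple // subSS.
  have := cE m mk; rewrite expnS.
  by move: (\sum_(j < m) _) (b ^ m) => S w; nia.
by rewrite partial // [nth 0 c _]nth_default ?size_tuple // muln0 addn0.
Qed.

Lemma carries_elim (n b k : nat) (d c : k.+1.-tuple nat) (j : nat) :
  1 < n -> carries n b d c -> j <= k ->
  (n ^ 2 - 1) * nth 0 d j + n * nth 0 c (k - j) + nth 0 c j
  = b * (n * nth 0 c (k - j).+1 + nth 0 c j.+1).
Proof.
move=> n1 [_ cE] jk.
by have := cE j jk; have := cE (k - j) (leq_subr j k); rewrite subKn //; nia.
Qed.

(** In [carries_elim] carries below [n] make the right-hand side at most
    [(n ^ 2 - 1) b]. The case of equality is kept because the digits of a
    number in base [b] must be strictly below [b]. *)
Lemma carries_digit_leq (n b k : nat) (d c : k.+1.-tuple nat) (j : nat) :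
  1 < n -> 0 < b -> carries n b d c -> (forall i, nth 0 c i < n) -> j <= k ->
  nth 0 d j < b \/ nth 0 c j.+1 = n - 1 /\ nth 0 c (k - j) = 0.
Proof.
move=> n1 b0 hc cn jk; have := carries_elim n1 hc jk.
have := cn j.+1; have := cn (k - j).+1.
move: (nth 0 c (k - j).+1) (nth 0 c (k - j)) => z u.
move: (nth 0 c j.+1) (nth 0 c j) (nth 0 d j) => y u' v zn yn elim.
case: (ltnP v b) => [|bv]; [by left | right].
have fac : n ^ 2 - 1 = n * (n - 1) + (n - 1) by clear -n1; nia.
rewrite fac in elim; set M := n * (n - 1) + (n - 1) in elim.
have Mv : M * b <= M * v by rewrite leq_mul2l bv orbT.
have zM : n * z <= n * (n - 1) by rewrite leq_mul2l; lia.
have bM : b * (n * z + y) <= b * M by rewrite leq_mul2l /M; lia.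
have bMC := mulnC b M.
have u0 : n * u = 0 by lia.
have top : n * z + y = M by apply/eqP; rewrite -(eqn_pmul2l b0); lia.
split; first by move: top; rewrite /M; lia.
by move/eqP: u0; rewrite muln_eq0; case: eqP n1 => [->|_ _ /eqP].
Qed.

(** * Digits of a shifted-symmetric palintiple in terms of its carries *)

(** The shares of a digit that come from its outgoing carry and from its
    incoming carry: [d_j = out_part c_(j+1) + in_part c_j]. *)
Definition out_part (n b x : nat) : nat := (b - n) * x %/ (n ^ 2 - 1).
Definition in_part (n b x : nat) : nat := (n * b - 1) * x %/ (n ^ 2 - 1).

Section ShiftedSymmetric.

Context {n b k : nat} {d c : k.+1.-tuple nat}.
Context (hd : shifted_symmetric_palintiple n b d c).

Lemma out_partE j :
  (n ^ 2 - 1) * out_part n b (nth 0 c j) = (b - n) * nth 0 c j.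
Proof.
by have /andP[h _] := shifted_symmetric_dvd j hd; rewrite mulnC divnK.
Qed.

Lemma in_partE j :
  (n ^ 2 - 1) * in_part n b (nth 0 c j) = (n * b - 1) * nth 0 c j.
Proof.
by have /andP[_ h] := shifted_symmetric_dvd j hd; rewrite mulnC divnK.
Qed.

Lemma out_part0 : out_part n b 0 = 0.
Proof. by rewrite /out_part muln0 div0n. Qed.

Lemma in_part0 : in_part n b 0 = 0.
Proof. by rewrite /in_part muln0 div0n. Qed.

Lemma modulus_gt0 : 0 < n ^ 2 - 1.
Proof. by have [[/andP[n1 _] _ _ _ _] _ _] := hd; nia. Qed.

(** Up to the leading digit this is [shifted_symmetric_digit] divided by
    [n ^ 2 - 1]; beyond it both sides are [0]. *)
Lemma digit_of_parts j :
  nth 0 d j = out_part n b (nth 0 c j.+1) + in_part n b (nth 0 c j).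
Proof.
have [jk|kj] := leqP j k.
  apply/eqP; rewrite -(eqn_pmul2l modulus_gt0) mulnDr out_partE in_partE.
  by rewrite (shifted_symmetric_digit hd jk).
by rewrite !nth_default ?size_tuple ?out_part0 ?in_part0 // ltnW.
Qed.

Lemma out_part_ltn_in_part j :
  0 < nth 0 c j -> out_part n b (nth 0 c j) < in_part n b (nth 0 c j).
Proof.
move=> cj; have [[/andP[n1 nb] _ _ _ _] _ _] := hd.
rewrite -(ltn_pmul2l modulus_gt0) out_partE in_partE ltn_pmul2r //.
by nia.
Qed.

Lemma out_part_leq_in_part j :
  out_part n b (nth 0 c j) <= in_part n b (nth 0 c j).
Proof.
case: (posnP (nth 0 c j)) => [->|/out_part_ltn_in_part/ltnW //].
by rewrite out_part0.
Qed.

Lemma out_part_gt0 j : 0 < nth 0 c j -> 0 < out_part n b (nth 0 c j).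
Proof.
move=> cj; have [[/andP[n1 nb] _ _ _ _] _ _] := hd.
by rewrite -(ltn_pmul2l modulus_gt0) muln0 out_partE muln_gt0 cj subn_gt0 nb.
Qed.

(** Since [c_(k+1) = 0 = c_0], shifted symmetry persists at [j = k+1], the
    position of the additional digit; the two lemmas after this one are the
    same fact at the neighbours, with [c_(-1) = 0 = c_(k+2)]. *)
Lemma carry_mirror j : j <= k.+1 -> nth 0 c (k.+1 - j) = nth 0 c j.
Proof.
have [_ [c0 _] sym] := hd.
rewrite leq_eqVlt => /orP[/eqP ->|jk].
  by rewrite subnn c0 nth_default // size_tuple.
by rewrite subSn // -sym.
Qed.

Lemma prev_carry_mirror j :
  j <= k.+1 -> prev_carry c (k.+1 - j) = nth 0 c j.+1.
Proof.
move=> jk; rewrite /prev_carry; have [_ [c0 _] _] := hd.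
move: jk; rewrite leq_eqVlt => /orP[/eqP ->|jk].
  by rewrite subnn [RHS]nth_default // size_tuple ltnW.
rewrite subSn //=.
by rewrite -(carry_mirror jk) subSS.
Qed.

Lemma next_carry_mirror j :
  j <= k.+1 -> nth 0 c (k.+1 - j).+1 = prev_carry c j.
Proof.
by move=> jk; rewrite -prev_carry_mirror ?leq_subr // subKn.
Qed.

(** [d_(k-j) = p_j + q_(j+1)] and [d_j = p_(j+1) + q_j] are positive
    combinations of the same two carries [c_j] and [c_(j+1)]. *)
Lemma digit_mirror_eq0 j : j <= k -> nth 0 d (k - j) = 0 -> nth 0 d j = 0.
Proof.
move=> jk; rewrite !digit_of_parts -subSn // carry_mirror; last exact: leqW.
rewrite -[k - j]/(k.+1 - j.+1) carry_mirror // => /eqP.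
rewrite addn_eq0 => /andP[/eqP P0 /eqP Q0].
have cj : nth 0 c j = 0.
  by case: (posnP (nth 0 c j)) => // /out_part_gt0; rewrite P0.
by have := out_part_leq_in_part j.+1; rewrite Q0 cj in_part0 addn0 leqn0 => /eqP.
Qed.

End ShiftedSymmetric.

(** * The digits whose carries are the given palintiple *)

(** The share of [x_j] that grows with [alpha], up to the factor
    [alpha / g]. *)
Definition lift_combination (n b N prev cur next : nat) : nat :=
  out_part n b next + N * out_part n b prev + (N + 1) * in_part n b cur.

Definition lifted_digit (n b N s alpha g : nat) (c : seq nat) (j : nat) : nat :=
  in_part n b (prev_carry c j)
  + (s * in_part n b (nth 0 c j) - out_part n b (nth 0 c j)) %/ (N - 1)
  + alpha * lift_combination n b N (prev_carry c j) (nth 0 c j) (nth 0 c j.+1)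
      %/ g.

Section Lift.

Context {n b k : nat} {d c : k.+1.-tuple nat}.
Context (hd : shifted_symmetric_palintiple n b d c).

(** Both sides equal [s (b - n) c_j / (n ^ 2 - 1)]. *)
Lemma scaled_parts (N s j : nat) :
  (b - n) * s = N * (n * b - 1) ->
  s * out_part n b (nth 0 c j) = N * in_part n b (nth 0 c j).
Proof.
move=> sE; apply/eqP; rewrite -(eqn_pmul2l (modulus_gt0 hd)); apply/eqP.
rewrite [LHS]mulnCA (out_partE hd) [RHS]mulnCA (in_partE hd) !mulnA -sE.
by rewrite [s * _]mulnC.
Qed.

(** The ratio [(n b - 1) / (b - n)] of [s] to [N] exceeds [1]. *)
Lemma scale_geq (N s : nat) : (b - n) * s = N * (n * b - 1) -> N <= s.
Proof.
move=> sE; have [[/andP[n1 nb] _ _ _ _] _ _] := hd.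
rewrite -(@leq_pmul2l (b - n)) ?subn_gt0 // sE mulnC leq_mul2l.
by apply/orP; right; clear -n1 nb; nia.
Qed.

Lemma lift_combinationE (N j : nat) :
  ((b - n) * (nth 0 c j.+1 + N * prev_carry c j)
     + (N + 1) * (n * b - 1) * nth 0 c j) %/ (n ^ 2 - 1)
  = lift_combination n b N (prev_carry c j) (nth 0 c j) (nth 0 c j.+1).
Proof.
have prevE : (n ^ 2 - 1) * out_part n b (prev_carry c j)
             = (b - n) * prev_carry c j.
  by case: j => [|j]; rewrite /prev_carry /= ?out_part0 ?muln0 ?(out_partE hd).
have -> : (b - n) * (nth 0 c j.+1 + N * prev_carry c j)
    + (N + 1) * (n * b - 1) * nth 0 c j
  = (n ^ 2 - 1)
    * lift_combination n b N (prev_carry c j) (nth 0 c j) (nth 0 c j.+1).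
  rewrite /lift_combination !mulnDr (out_partE hd) ![_ * (N * _)]mulnCA prevE.
  by rewrite [_ * ((N + 1) * _)]mulnCA (in_partE hd) -!mulnA.
by rewrite mulKn // (modulus_gt0 hd).
Qed.

Context {N s alpha g : nat}.
Context (N1 : 1 < N) (sE : (b - n) * s = N * (n * b - 1)).
Context (g_gt0 : 0 < g) (gN : g %| N ^ 2 - 1).
Context (hr : forall j, j <= k.+1 ->
  N - 1 %| s * in_part n b (nth 0 c j) - out_part n b (nth 0 c j)).
Context (ht : forall j, j <= k.+1 ->
  g %| alpha
       * lift_combination n b N (prev_carry c j) (nth 0 c j) (nth 0 c j.+1)).

Let x := lifted_digit n b N s alpha g c.

(** Replacing [j] by [k+1-j] fixes [c_j] and exchanges [c_(j-1)] with
    [c_(j+1)], so the equation relates the parts of three carries only. *)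
Lemma lifted_digits_carries j : j <= k.+1 ->
  N * x (k.+1 - j) + nth 0 (0 :: d) j
  = x j + (s + alpha * ((N ^ 2 - 1) %/ g)) * nth 0 (0 :: d) j.+1.
Proof.
move=> jk; rewrite /x /lifted_digit.
rewrite (prev_carry_mirror hd jk) (carry_mirror hd jk) (next_carry_mirror hd jk).
have dprev : nth 0 (0 :: d) j
    = out_part n b (nth 0 c j) + in_part n b (prev_carry c j).
  case: j {jk} => [|j] /=; last by rewrite (digit_of_parts hd).
  by have [_ [-> _] _] := hd; rewrite out_part0 in_part0.
rewrite dprev /= (digit_of_parts hd).
have tj := ht jk; have tj' := ht (leq_subr j k.+1).
rewrite (prev_carry_mirror hd jk) (carry_mirror hd jk)
  (next_carry_mirror hd jk) in tj'.
have rE := divnK (hr jk); move: rE tj tj'.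
have PQ := out_part_leq_in_part hd j.
have sP := scaled_parts j.+1 sE.
have sN := scale_geq sE.
have /dvdnP[w wE] := gN.
rewrite wE mulnK //; move: PQ sP; rewrite /lift_combination.
move: (out_part n b (nth 0 c j)) (in_part n b (nth 0 c j)) => p q.
move: (out_part n b (nth 0 c j.+1)) (in_part n b (nth 0 c j.+1)) => p' q'.
move: (out_part n b (prev_carry c j)) (in_part n b (prev_carry c j)) => p0 q0.
move=> pq sp /[swap] /dvdnP[t tE] /[swap] /dvdnP[t' tE'].
rewrite tE tE' !mulnK //; move: (_ %/ (N - 1)) => r rE.
(* The carry equation splits into a part free of alpha and a multiple of
   alpha / g. *)
have main : N * r + p = r + s * q.
  have psq : p <= s * q.
    by apply: leq_trans pq _; rewrite leq_pmull // (leq_trans _ sN) // ltnW.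
  rewrite -(subnK psq) -rE mulnBr muln1 mulnC addnA subnKC //.
  by rewrite leq_pmulr // ltnW.
have shift : N * t' = t + alpha * w * (p' + q).
  apply/eqP; rewrite -(eqn_pmul2r g_gt0) mulnDl -mulnA -tE' -tE; apply/eqP.
  have -> : alpha * w * (p' + q) * g = alpha * (p' + q) * (w * g) by lia.
  rewrite -wE; clear -N1; nia.
clear -main shift sp; nia.
Qed.

End Lift.

Theorem theorem3 (n b k : nat) (d c : k.+1.-tuple nat)
  (hd : shifted_symmetric_palintiple n b d c)
  (nhat s : nat)
  (hs_int : b - n %| nhat * (n * b - 1))
  (hs : s = nhat * (n * b - 1) %/ (b - n))
  (hnhat : forall j : nat, j <= k -> nth 0 d j < nhat)
  (hcong : forall j : nat, j <= k ->
     s * ((n * b - 1) * nth 0 c j %/ (n ^ 2 - 1))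
       = (b - n) * nth 0 c j %/ (n ^ 2 - 1) %[mod nhat - 1])
  (alpha : nat) (halpha : 1 <= alpha)
  (hdiv : forall j : nat, j <= k ->
     gcdn (nth 0 d 0) (nhat ^ 2 - 1)
       %| alpha * (((b - n) * (nth 0 c j.+1 + nhat * prev_carry c j)
                    + (nhat + 1) * (n * b - 1) * nth 0 c j) %/ (n ^ 2 - 1))) :
  exists dhat : k.+2.-tuple nat,
    asymmetric_palintiple nhat
      (s + alpha * ((nhat ^ 2 - 1) %/ gcdn (nth 0 d 0) (nhat ^ 2 - 1)))
      dhat [tuple of 0 :: d].
Proof.
have [[/andP[n1 nb] k1 _ dk _] [c0 _] _] := hd.
have N1 : 1 < nhat by have := hnhat k (leqnn k); lia.
have NN : 0 < nhat ^ 2 - 1 by nia.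
have sE : (b - n) * s = nhat * (n * b - 1) by rewrite hs mulnC divnK.
have sN := scale_geq hd sE.
have ck1 : nth 0 c k.+1 = 0 by rewrite nth_default // size_tuple.
have ck2 : nth 0 c k.+2 = 0 by rewrite nth_default // size_tuple.
have d0E : nth 0 d 0 = out_part n b (nth 0 c 1).
  by rewrite (digit_of_parts hd) c0 in_part0 addn0.
have cmir : nth 0 c 1 = nth 0 c k by rewrite -(carry_mirror hd) // subSS subn0.
have dkE : nth 0 d k = in_part n b (nth 0 c 1).
  by rewrite (digit_of_parts hd) ck1 out_part0 cmir.
move: hdiv; set g := gcdn _ _ => hdiv.
have g0 : 0 < g by rewrite gcdn_gt0 NN orbT.
have gN : g %| nhat ^ 2 - 1 := dvdn_gcdr _ _.
have w0 : 0 < (nhat ^ 2 - 1) %/ g by rewrite divn_gt0 // dvdn_leq.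
have hr j : j <= k.+1 ->
    nhat - 1 %| s * in_part n b (nth 0 c j) - out_part n b (nth 0 c j).
  rewrite leq_eqVlt => /orP[/eqP ->|jk].
    by rewrite ck1 in_part0 out_part0 muln0 dvdn0.
  have PQ := out_part_leq_in_part hd j.
  have /eqP := hcong j jk; rewrite eqn_mod_dvd //.
  by apply: leq_trans PQ _; rewrite leq_pmull //; lia.
have ht j : j <= k.+1 ->
    g %| alpha
       * lift_combination n b nhat (prev_carry c j) (nth 0 c j) (nth 0 c j.+1).
  rewrite leq_eqVlt => /orP[/eqP ->|jk]; last first.
    by rewrite -(lift_combinationE hd); apply: hdiv.
  (* At the new leading position only N p_k survives, and p_k = p_1 = d_0. *)
  rewrite /lift_combination ck1 ck2 out_part0 in_part0 muln0 addn0 add0n /=.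
  by rewrite /prev_carry /= -cmir -d0E; do 2!apply: dvdn_mull; apply: dvdn_gcdl.
have xE := lifted_digits_carries hd N1 sE g0 gN hr ht.
set B := s + _ in xE *.
set x := lifted_digit n b nhat s alpha g c in xE.
pose dhat : k.+2.-tuple nat := [tuple of mkseq x k.+2].
have nth_dhat j : j <= k.+1 -> nth 0 dhat j = x j by move=> jk; rewrite nth_mkseq.
have hc : carries nhat B dhat [tuple of 0 :: d].
  split=> // j jk; rewrite !nth_dhat ?leq_subr //; exact: xE.
have BN : nhat < B by rewrite /B; nia.
have dN j : nth 0 d j < nhat.
  have [/hnhat //|kj] := leqP j k.
  by rewrite nth_default ?size_tuple //; lia.
have chN j : nth 0 [tuple of 0 :: d] j < nhat by case: j => [|j] //=; lia.
exists dhat; split=> //; first split=> //.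
- by rewrite N1.
- move=> j jk; have B0 : 0 < B by exact: leq_ltn_trans (leq0n _) BN.
  have [//|[/= E1 E2]] := carries_digit_leq N1 B0 hc chN jk.
  move: jk; rewrite leq_eqVlt => /orP[/eqP jE|jk].
    by move: E1; rewrite jE nth_default ?size_tuple //; lia.
  by move: E2; rewrite subSn //= => /(digit_mirror_eq0 hd jk); rewrite E1; lia.
- rewrite nth_dhat // /x /lifted_digit /prev_carry [nth _ _ _]/= -cmir -dkE.
  by apply/eqP; rewrite -addnA addn_eq0 negb_and; move/eqP: dk => ->.
- exact: carries_value hc.
- move=> /(_ 0 (leq0n _)); rewrite subn0 /=; lia.
- move=> /(_ 1); rewrite subSS subn0 /= => /(_ isT).
  rewrite d0E dkE => E.
  have : 0 < nth 0 c 1.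
    by case: (posnP (nth 0 c 1)) => // c1; rewrite dkE c1 in_part0 in dk.
  by move=> /(out_part_ltn_in_part hd); rewrite E ltnn.
Qed.
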